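(* Let $\Lambda$ be a $k$-graph such that for each $p\in\mathbb N^k$ the restrictions of $r$ and $s$ to $\Lambda^p$ are surjective (onto $\Lambda^0$) and finite-to-one. The $\mathbb Z^k$-action $n\mapsto\sigma^n$ by shifts on $\Lambda^\Delta$ is expansive in the sense that there is an $\varepsilon>0$ such that for all $x,y\in\Lambda^\Delta$, if $\rho(\sigma^n(x),\sigma^n(y))<\varepsilon$ for all $n\in\mathbb Z^k$, then $x=y$. Moreover, if $\Lambda$ is primitive, then $\sigma$ is topologically mixing in the sense that for any two nonempty open sets $U$ and $V$ in $\Lambda^\Delta$ there is a $Q\in\mathbb Z^k$ such that $U\cap\sigma^q(V)\ne\varnothing$ for all $q\ge Q$.
   Context: Let $k\ge 1$; $\mathbb N=\{0,1,2,\dots\}$; $\mathbb N^k,\mathbb Z^k$ carry the coordinatewise order. A $k$-graph $(\Lambda,d)$ is a countable small category $\Lambda$ with a functor $d:\Lambda\to\mathbb N^k$ (degree) such that whenever $d(\lambda)=n_1+n_2$ there are unique $\nu_1,\nu_2\in\Lambda$ with $\lambda=\nu_1\nu_2$, $d(\nu_i)=n_i$. Put $\Lambda^n=d^{-1}(n)$; objects are identified with $\Lambda^0$; $r,s:\Lambda\to\Lambda^0$ are range and source; $\lambda\mu$ is defined when $s(\lambda)=r(\mu)$. $\Lambda$ is primitive if there is a nonzero $p\in\mathbb N^k$ such that for all $u,v\in\Lambda^0$ there is $\lambda\in\Lambda^p$ with $r(\lambda)=u$, $s(\lambda)=v$. $\Delta=\{(m,n)\in\mathbb Z^k\times\mathbb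 Z^k:m\le n\}$ is a $k$-graph with $r(m,n)=m$, $s(m,n)=n$, $(\ell,m)(m,n)=(\ell,n)$, $d(m,n)=n-m$. $\Lambda^\Delta$ is the set of degree-preserving functors $x:\Delta\to\Lambda$; write $x(n)=x(n,n)$. It has the topology with basis $Z(\lambda,n)=\{x:x(n,n+d(\lambda))=\lambda\}$ ($\lambda\in\Lambda$, $n\in\mathbb Z^k$). The shift is $(\sigma^nx)(\ell,m)=x(\ell+n,m+n)$ for $n\in\mathbb Z^k$; each $\sigma^n$ is a homeomorphism. Metric: let $e=(1,\dots,1)\in\mathbb Z^k$, $\theta_j=(-je,je)\in\Delta$ for $j\in\mathbb N$. Put $h(x,y)=0$ if $x(0)\neq y(0)$ and $h(x,y)=1+\sup\{j\in\mathbb N:x(\theta_j)=y(\theta_j)\}$ otherwise. Fix $0<r<1$; then $\rho(x,y)=r^{h(x,y)}$ (with $r^\infty=0$) is a metric inducing the topology of $\Lambda^\Delta$. *)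

(* Defs.v *)
From HB Require Import structures.
From mathcomp Require Import all_boot all_order all_algebra.
From mathcomp Require Import all_classical all_reals all_analysis.
From mathcomp Require Import zify.

Set Implicit Arguments.
Unset Strict Implicit.
Unset Printing Implicit Defensive.

Import Order.TTheory GRing.Theory Num.Theory.

Local Open Scope classical_set_scope.
Local Open Scope ring_scope.

(* A total [compose] is used; [compose l m] is the composite l m when
   [src l = ran m], and is unconstrained (and never used) otherwise. *)
Record category := Category {
  obj : Type;
  mor : Type;
  ran : mor -> obj;
  src : mor -> obj;
  idm : obj -> mor;
  compose : mor -> mor -> mor;
  ran_idm : forall v, ran (idm v) = v;
  src_idm : forall v, src (idm v) = v;
  ran_comp : forall l m, src l = ran m -> ran (compose l m) = ran l;
  src_comp : forall l m, src l = ran m -> src (compose l m) = src m;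
  comp_idl : forall l, compose (idm (ran l)) l = l;
  comp_idr : forall l, compose l (idm (src l)) = l;
  compA : forall l m n, src l = ran m -> src m = ran n ->
    compose l (compose m n) = compose (compose l m) n
}.

Record functor (C D : category) := Functor {
  fobj : obj C -> obj D;
  fmor :> mor C -> mor D;
  ran_fmor : forall l, ran (fmor l) = fobj (ran l);
  src_fmor : forall l, src (fmor l) = fobj (src l);
  fmor_idm : forall v, fmor (idm v) = idm (fobj v);
  fmor_comp : forall l m, src l = ran m ->
    fmor (compose l m) = compose (fmor l) (fmor m)
}.

Notation Nvec k := {ffun 'I_k -> nat}.
Notation Zvec k := {ffun 'I_k -> int}.

(* [deg_idm] and [deg_comp] say that deg is a functor to the one-object
   category N^k. The objects, i.e. Λ^0, are kept as a separate type; the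
   identification of v with its identity morphism is [idm]. *)
Record kgraph (k : nat) := KGraph {
  kcat :> category;
  countable_mor : countable [set: mor kcat];
  deg : mor kcat -> Nvec k;
  deg_idm : forall v, deg (idm v) = 0;
  deg_comp : forall l m, src l = ran m -> deg (compose l m) = deg l + deg m;
  factorization : forall l (n1 n2 : Nvec k), deg l = n1 + n2 ->
    exists! nu : mor kcat * mor kcat,
      [/\ src nu.1 = ran nu.2, l = compose nu.1 nu.2,
          deg nu.1 = n1 & deg nu.2 = n2]
}.

Definition primitive (k : nat) (L : kgraph k) : Prop :=
  exists p : Nvec k, p <> 0 /\
    forall u v : obj L, exists l : mor L, [/\ deg l = p, ran l = u & src l = v].

Section Delta.
Variable k : nat.
Implicit Types m n : Zvec k.

Definition lez m n : bool := [forall i, m i <= n i].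

Lemma lezP m n : reflect (forall i, m i <= n i) (lez m n).
Proof. exact: forallP. Qed.

Lemma lez_refl m : lez m m.
Proof. by apply/lezP. Qed.

Lemma lez_trans n m l : lez m n -> lez n l -> lez m l.
Proof.
by move=> /lezP mn /lezP nl; apply/lezP => i; exact: le_trans (mn i) (nl i).
Qed.

Definition zvec (p : Nvec k) : Zvec k := [ffun i => (p i)%:Z].

Definition delta := {mn : Zvec k * Zvec k | lez mn.1 mn.2}.

Definition delta_ran (a : delta) : Zvec k := (val a).1.
Definition delta_src (a : delta) : Zvec k := (val a).2.
Definition delta_idm m : delta := exist _ (m, m) (lez_refl m).

(* The default value [a] is returned only when [a] and [b] are not
   composable. *)
Definition delta_comp (a b : delta) : delta :=
  insubd a (delta_ran a, delta_src b).
Definition delta_deg (a : delta) : Nvec k :=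
  [ffun i => `|(delta_src a i - delta_ran a i)%R|%N].

Lemma val_delta_comp a b : delta_src a = delta_ran b ->
  val (delta_comp a b) = (delta_ran a, delta_src b).
Proof.
move=> ab; rewrite val_insubd /= (@lez_trans (delta_src a)) //; first exact: valP a.
by rewrite ab; exact: valP b.
Qed.

Lemma delta_ext a b :
  delta_ran a = delta_ran b -> delta_src a = delta_src b -> a = b.
Proof.
rewrite /delta_ran /delta_src => h1 h2; apply: val_inj.
by rewrite [LHS]surjective_pairing [RHS]surjective_pairing h1 h2.
Qed.

Lemma delta_ran_comp a b : delta_src a = delta_ran b ->
  delta_ran (delta_comp a b) = delta_ran a.
Proof. by move=> ab; rewrite {1}/delta_ran val_delta_comp. Qed.

Lemma delta_src_comp a b : delta_src a = delta_ran b ->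
  delta_src (delta_comp a b) = delta_src b.
Proof. by move=> ab; rewrite {1}/delta_src val_delta_comp. Qed.

Lemma delta_comp_idl a : delta_comp (delta_idm (delta_ran a)) a = a.
Proof. by apply: delta_ext; rewrite ?delta_ran_comp ?delta_src_comp. Qed.

Lemma delta_comp_idr a : delta_comp a (delta_idm (delta_src a)) = a.
Proof. by apply: delta_ext; rewrite ?delta_ran_comp ?delta_src_comp. Qed.

Lemma delta_compA a b c :
  delta_src a = delta_ran b -> delta_src b = delta_ran c ->
  delta_comp a (delta_comp b c) = delta_comp (delta_comp a b) c.
Proof.
move=> ab bc; apply: delta_ext.
  by rewrite !delta_ran_comp ?delta_src_comp.
by rewrite !delta_src_comp ?delta_ran_comp // delta_src_comp.
Qed.

Definition Delta_cat : category :=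
  @Category (Zvec k) delta delta_ran delta_src delta_idm delta_comp
    (fun=> erefl) (fun=> erefl) delta_ran_comp delta_src_comp
    delta_comp_idl delta_comp_idr delta_compA.

Lemma delta_deg_idm m : delta_deg (delta_idm m) = 0.
Proof. by apply/ffunP => i; rewrite !ffunE subrr. Qed.

Lemma delta_deg_comp a b : delta_src a = delta_ran b ->
  delta_deg (delta_comp a b) = delta_deg a + delta_deg b.
Proof.
move=> ab; apply/ffunP => i.
rewrite !ffunE delta_ran_comp // delta_src_comp // -ab.
have /lezP/(_ i) := valP a; have /lezP/(_ i) := valP b.
rewrite -/(delta_ran a) -/(delta_src a) -/(delta_ran b) -/(delta_src b) -ab.
have -> (u v : nat) : (u + v)%R = (u + v)%N by [].
by move: (delta_ran a i) (delta_src a i) (delta_src b i) => u v w; lia.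
Qed.

Lemma zvec_delta_deg a : delta_src a = delta_ran a + zvec (delta_deg a).
Proof.
apply/ffunP => i; rewrite !ffunE; have /lezP/(_ i) := valP a.
rewrite -/(delta_ran a) -/(delta_src a).
by move: (delta_ran a i) (delta_src a i) => u v; lia.
Qed.

Lemma lez_addr m (p : Nvec k) : lez m (m + zvec p).
Proof. by apply/lezP => i; rewrite !ffunE lerDl. Qed.

(* seg m p is the element (m, m + p) of Δ. *)
Definition seg m (p : Nvec k) : delta := exist _ (m, m + zvec p) (lez_addr m p).

Lemma delta_deg_seg m p : delta_deg (seg m p) = p.
Proof.
apply/ffunP => i; rewrite ffunE /delta_src /delta_ran /= !ffunE.
by rewrite [X in absz X]addrC addKr.
Qed.

Lemma zvecD (p q : Nvec k) : zvec (p + q) = zvec p + zvec q.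
Proof. by apply/ffunP => i; rewrite !ffunE. Qed.

Lemma delta_factorization a (n1 n2 : Nvec k) : delta_deg a = n1 + n2 ->
  exists! nu : delta * delta,
    [/\ delta_src nu.1 = delta_ran nu.2, a = delta_comp nu.1 nu.2,
        delta_deg nu.1 = n1 & delta_deg nu.2 = n2].
Proof.
move=> da; exists (seg (delta_ran a) n1, seg (delta_ran a + zvec n1) n2).
split=> [|[b c] /= [bc abc b1 c2]].
  split; rewrite ?delta_deg_seg //; apply: delta_ext.
    by rewrite delta_ran_comp.
  rewrite delta_src_comp // zvec_delta_deg da zvecD addrA.
  by [].
have rb : delta_ran b = delta_ran a by rewrite abc delta_ran_comp.
have sb : delta_src b = delta_ran a + zvec n1 by rewrite zvec_delta_deg rb b1.
congr pair; apply: delta_ext => //=; first by rewrite -bc sb.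
by rewrite [RHS]zvec_delta_deg -bc sb c2.
Qed.

Definition Delta : kgraph k :=
  @KGraph k Delta_cat (countableP _) delta_deg delta_deg_idm delta_deg_comp
    delta_factorization.

Lemma lez_add2r n l m : lez l m -> lez (l + n) (m + n).
Proof. by move=> /lezP lm; apply/lezP => i; rewrite !ffunE lerD2r. Qed.

Definition translate n (a : delta) : delta :=
  exist _ (delta_ran a + n, delta_src a + n) (lez_add2r n (valP a)).

Definition evec : Zvec k := [ffun=> 1].

Lemma lez_theta (j : nat) : lez (- (evec *+ j)) (evec *+ j).
Proof.
apply/lezP => i; rewrite !ffunE !ffunMnE !ffunE.
by rewrite (@le_trans _ _ 0) ?oppr_le0 ?mulrn_wge0.
Qed.

Definition theta (j : nat) : delta :=
  exist _ (- (evec *+ j), evec *+ j) (lez_theta j).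

End Delta.

(* Λ^Δ: the degree-preserving functors Δ -> Λ. *)
Record dpaths (k : nat) (L : kgraph k) := DPath {
  dpath_fun :> functor (Delta k) L;
  deg_dpath : forall a, deg (dpath_fun a) = @deg k (Delta k) a
}.

Section Paths.
Variables (k : nat) (L : kgraph k).
Implicit Types x y : dpaths L.

(* x(n) = x(n, n), a morphism of degree 0. *)
Definition dpath_at x (n : Zvec k) : mor L := x (delta_idm n).

Section Shift.
Variables (n : Zvec k) (x : dpaths L).

Let fo (m : obj (Delta k)) : obj L := fobj x (m + n).
Let fm (a : mor (Delta k)) : mor L := x (translate n a).

Fact shift_ran a : ran (fm a) = fo (ran a).
Proof. by rewrite /fm ran_fmor. Qed.

Fact shift_src a : src (fm a) = fo (src a).
Proof. by rewrite /fm src_fmor. Qed.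

Fact shift_idm m : fm (idm m) = idm (fo m).
Proof.
by rewrite /fo -fmor_idm /fm; congr (fmor x _); exact: delta_ext.
Qed.

Fact shift_comp (a b : mor (Delta k)) : src a = ran b ->
  fm (compose a b) = compose (fm a) (fm b).
Proof.
move=> /= ab; have tab : delta_src (translate n a) = delta_ran (translate n b).
  by rewrite /delta_src /delta_ran /= ab.
rewrite /fm -fmor_comp //; congr (fmor x _); apply: delta_ext => /=.
  rewrite delta_ran_comp // [LHS]/delta_ran /= delta_ran_comp //.
by rewrite delta_src_comp // [LHS]/delta_src /= delta_src_comp.
Qed.

Fact shift_deg a : deg (fm a) = @deg k (Delta k) a.
Proof.
rewrite /fm deg_dpath /=; apply/ffunP => i.
rewrite [LHS]ffunE {1}/delta_src {1}/delta_ran /= !ffunE.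
by rewrite opprD addrACA subrr addr0.
Qed.

(* (σ^n x)(l, m) = x(l + n, m + n). *)
Definition dshift : dpaths L :=
  @DPath k L (@Functor (Delta k) L fo fm shift_ran shift_src shift_idm
    shift_comp) shift_deg.

End Shift.

Definition cylinder (l : mor L) (n : Zvec k) : set (dpaths L) :=
  [set x | x (seg n (deg l)) = l].

Definition cylinders : set (set (dpaths L)) :=
  [set A | exists l n, A = cylinder l n].

Lemma cylinder_dpath x n p : cylinder (x (seg n p)) n x.
Proof. by rewrite /cylinder /= deg_dpath /= delta_deg_seg. Qed.

Lemma cylinders_cover : \bigcup_(A in cylinders) A = setT.
Proof.
apply/seteqP; split=> // x _; exists (cylinder (x (seg 0 0)) 0).
  by exists (x (seg 0 0)), 0.
exact: cylinder_dpath.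
Qed.

(* By unique factorization, agreement on (m, n) gives agreement on any
   subinterval. *)
Lemma dpath_sub x y (a b : delta k) :
  lez (delta_ran a) (delta_ran b) -> lez (delta_src b) (delta_src a) ->
  x a = y a -> x b = y b.
Proof.
move=> ab ba xya.
pose u : delta k := exist _ (delta_ran a, delta_ran b) ab.
pose w : delta k := exist _ (delta_src b, delta_src a) ba.
have bw : delta_src b = delta_ran w by [].
have ubw : delta_src u = delta_ran (delta_comp b w).
  by rewrite delta_ran_comp.
have au : a = delta_comp u (delta_comp b w).
  by apply: delta_ext; rewrite ?delta_ran_comp ?delta_src_comp.
have xyc : forall c d : delta k, delta_src c = delta_ran d ->
    x (delta_comp c d) = y (delta_comp c d) -> x c = y c /\ x d = y d.
  move=> c d cd xycd.
  have /factorization[nu [_ nuP]] : deg (x (delta_comp c d)) =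
      delta_deg c + delta_deg d.
    by rewrite deg_dpath /= delta_deg_comp.
  have fx : nu = (x c, x d).
    apply: nuP; split; rewrite /= ?deg_dpath //.
      by rewrite src_fmor ran_fmor; congr (fobj x _).
    exact: (@fmor_comp _ _ x).
  have fy : nu = (y c, y d).
    apply: nuP; split; rewrite /= ?deg_dpath //.
      by rewrite src_fmor ran_fmor; congr (fobj y _).
    by rewrite xycd; exact: (@fmor_comp _ _ y).
  by move: fy; rewrite fx => -[].
have [_ xybw] : x u = y u /\ x (delta_comp b w) = y (delta_comp b w).
  by apply: xyc => //; rewrite -au.
by have [] := xyc _ _ bw xybw.
Qed.

Lemma cylinders_join (A B : set (dpaths L)) x :
  cylinders A -> cylinders B -> A x -> B x ->
  exists C, [/\ cylinders C, C x & C `<=` A `&` B].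
Proof.
move=> [l [m ->]] [l' [m' ->]] xl xl'.
pose n : Zvec k := [ffun i => Num.min (m i) (m' i)].
pose p : Nvec k := [ffun i =>
  `|(Num.max (m i + (deg l i)%:Z) (m' i + (deg l' i)%:Z) - n i)%R|%N].
exists (cylinder (x (seg n p)) n); split.
- by exists (x (seg n p)), n.
- exact: cylinder_dpath.
move=> y; rewrite {1}/cylinder /= deg_dpath /= delta_deg_seg => yx.
split; rewrite /cylinder /=.
  rewrite -[RHS]xl; apply: dpath_sub yx; apply/lezP => i.
    rewrite /delta_ran /= !ffunE.
    by move: (m i) (m' i) => u v; lia.
  rewrite /delta_src /= !ffunE.
  by move: (m i) (m' i) (deg l i) (deg l' i) => u v c d; lia.
rewrite -[RHS]xl'; apply: dpath_sub yx; apply/lezP => i.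
  rewrite /delta_ran /= !ffunE.
  by move: (m i) (m' i) => u v; lia.
rewrite /delta_src /= !ffunE.
by move: (m i) (m' i) (deg l i) (deg l' i) => u v c d; lia.
Qed.

HB.instance Definition _ := gen_eqMixin (dpaths L).
HB.instance Definition _ := gen_choiceMixin (dpaths L).

(* The topology on Λ^Δ with basis the cylinders Z(λ, n). *)
HB.instance Definition _ := @isBaseTopological.Build (dpaths L)
  (set (dpaths L)) cylinders (fun A => A) cylinders_cover
  (fun A B x => @cylinders_join A B x).

Variable R : realType.

Definition agreement (x y : dpaths L) : \bar R :=
  if `[< dpath_at x 0 = dpath_at y 0 >] then
    (1 + ereal_sup [set (j%:R)%:E | j in
           [set j : nat | x (theta k j) = y (theta k j)]])%E
  else 0%E.

(* ρ(x, y) = r ^ h(x, y), with r ^ oo = 0; h takes values in N and +oo, so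
   the branch -oo is never used. *)
Definition rho (r : R) (x y : dpaths L) : R :=
  match agreement x y with
  | h%:E => r `^ h
  | _ => 0
  end.

End Paths.

(* Main.v *)
(** If rho(x, y) < r then x and y agree on (-e, e), so two paths all of whose
    shifts are r-close agree on every unit cube (n, n + e), hence by composition
    on every interval: r is an expansivity constant. For mixing, choose cylinders
    Z(l, m) in U and Z(l', n) in V. For q large, primitivity together with the
    surjectivity of r gives a morphism t from s(l') to r(l) of exactly the degree
    that separates the position n - q + d(l') from m; any bi-infinite extension
    z of l' t l, placed at n - q, lies in U and in the q-th shift of V. *)

Require Import Defs.
From mathcomp Require Import all_boot all_order all_algebra.
From mathcomp Require Import all_classical all_reals all_analysis.
From mathcomp Require Import zify.

Import Order.TTheory GRing.Theory Num.Theory.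

Local Open Scope classical_set_scope.
Local Open Scope ring_scope.

(** * Cancellation in a [k]-graph, and extension of a finite path to a bi-infinite one *)

Section Factorization.
Set Implicit Arguments.
Unset Strict Implicit.
Context {k : nat} {L : kgraph k}.
Implicit Types (l u v w : mor L) (a b : delta k) (M : Zvec k).

(** The object map is recovered from the morphism map as the range of the image of an identity; the
    law fields are propositions, hence irrelevant. *)
Lemma dpath_ext (x y : dpaths L) : (forall a, x a = y a) -> x = y.
Proof.
move=> xy; have fo : fobj x = fobj y.
  apply/funext => n; have := congr1 (@ran L) (xy (delta_idm n)).
  by rewrite !ran_fmor.
have {}xy : fmor x = fmor y by apply/funext.
case: x y fo xy => [[fx mx x1 x2 x3 x4] dx] [[fy my y1 y2 y3 y4] dy] /= fo fm.
subst fy my.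
by rewrite (Prop_irrelevance x1 y1) (Prop_irrelevance x2 y2)
  (Prop_irrelevance x3 y3) (Prop_irrelevance x4 y4) in dx *;
  rewrite (Prop_irrelevance dx dy).
Qed.

(** Cancelling in [deg u + deg v = deg u' + deg v'] gives equal second degrees, so uniqueness of
    factorization identifies the two pairs. *)
Lemma compose_inj u v u' v' : src u = ran v -> src u' = ran v' ->
  compose u v = compose u' v' -> deg u = deg u' -> u = u' /\ v = v'.
Proof.
move=> uv uv' e du; have dv : deg v = deg v'.
  have := congr1 (@deg k L) e; rewrite !deg_comp // du => /ffunP dd.
  by apply/ffunP => i; have := dd i; rewrite !ffunE => /addnI.
have /factorization[nu [_ nuP]] := deg_comp uv.
have e1 : nu = (u, v) by apply: nuP.
have e2 : nu = (u', v') by apply: nuP.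
by move: e2; rewrite e1 => -[].
Qed.

(** Both [l (idm (src l))] and [(idm (ran l)) l] factor [l] with degrees (0, 0). *)
Lemma deg0_idm l : deg l = 0 -> l = idm (ran l).
Proof.
move=> dl; have [] // := @compose_inj l (idm (src l)) (idm (ran l)) l.
- by rewrite ran_idm.
- by rewrite src_idm.
- by rewrite comp_idl comp_idr.
- by rewrite deg_idm.
Qed.

Lemma zvec_inj : injective (@zvec k).
Proof.
move=> p q /ffunP e; apply/ffunP => i; have := e i.
by rewrite !ffunE => -[].
Qed.

Lemma lez_zvecP (m n : Zvec k) : lez m n -> exists p, n = m + zvec p.
Proof.
move=> mn; exists (delta_deg (exist _ (m, n) mn : delta k)).
exact: (zvec_delta_deg (exist _ (m, n) mn : delta k)).
Qed.

(* [v] is the segment over the interval [a] of the path [l], where [l] is placed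
   on the interval (M, M + deg l). *)
Definition segment l M a v : Prop := exists u w,
  [/\ src u = ran v, src v = ran w, l = compose u (compose v w),
      delta_ran a = M + zvec (deg u) & delta_deg a = deg v].

(** The left end of [a] fixes the degree of the prefix and the length of [a] that of the segment, so
    [compose_inj] applies twice. *)
Lemma segment_inj l M a v v' : segment l M a v -> segment l M a v' -> v = v'.
Proof.
move=> [u [w [uv vw -> ra da]]] [u' [w' [uv' vw' e ra' da']]].
have du : deg u = deg u' by apply/zvec_inj/(addrI M); rewrite -ra.
have [||_ e'] := compose_inj _ _ e du; rewrite ?ran_comp //.
by have [] := compose_inj vw vw' e'; rewrite -?da.
Qed.

(** Cut [l] at the common end of [a] and [b]: [(u v) t] and [u' (w t')] have first factors of equal
    degree, hence [t = w t']. *)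
Lemma segment_comp l M a b v w : delta_src a = delta_ran b ->
  segment l M a v -> segment l M b w ->
  src v = ran w /\ segment l M (delta_comp a b) (compose v w).
Proof.
move=> ab [u [t [uv vt -> ra da]]] [u' [t' [uw' wt' e rb db]]].
have du : deg (compose u v) = deg u'.
  apply/zvec_inj/(addrI M).
  by rewrite -rb -ab zvec_delta_deg ra da deg_comp // zvecD addrA.
have [||||e1 e2] := @compose_inj (compose u v) t u' (compose w t').
- by rewrite src_comp.
- by rewrite ran_comp.
- by rewrite -Defs.compA.
- by [].
have vw : src v = ran w by rewrite -uw' -e1 src_comp.
split=> //; exists u, t'; split.
- by rewrite ran_comp.
- by rewrite src_comp.
- by rewrite e2 -(Defs.compA vw wt').
- by rewrite delta_ran_comp.
- by rewrite delta_deg_comp // deg_comp // da db.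
Qed.

Lemma segment_ex l M a : lez M (delta_ran a) ->
  lez (delta_src a) (M + zvec (deg l)) -> exists v, segment l M a v.
Proof.
move=> /lez_zvecP[p ra] /lez_zvecP[q sa].
have : deg l = p + (delta_deg a + q).
  apply/zvec_inj/(addrI M).
  by rewrite sa zvec_delta_deg ra !zvecD !addrA.
move=> /factorization[[u t] [[/= ut -> du dt] _]].
have /factorization[[v w] [[/= vw e dv dw] _]] := dt.
exists v, u, w; split; rewrite ?du -?e //.
by rewrite ut e ran_comp.
Qed.

(** Moving the starting position left by [deg s] keeps the old part of the path at its
    coordinates. *)
Lemma segment_widen l M a v s t : src s = ran l -> src l = ran t ->
  segment l M a v ->
  segment (compose s (compose l t)) (M - zvec (deg s)) a v.
Proof.
move=> sl lt [u [w [uv vw e ra da]]]; subst l.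
rewrite ran_comp ?ran_comp // in sl.
rewrite src_comp ?ran_comp ?src_comp // in lt.
exists (compose s u), (compose w t); split=> //.
- by rewrite src_comp.
- by rewrite ran_comp.
- by rewrite -!Defs.compA ?ran_comp ?src_comp ?ran_comp.
- by rewrite ra deg_comp // zvecD addrA subrK.
Qed.

Definition ones : Nvec k := [ffun=> 1%N].

Lemma zvec_ones : zvec ones = evec k.
Proof. by apply/ffunP => i; rewrite !ffunE. Qed.

(* The path [l] is prolonged by one unit in all directions at both ends,
   repeatedly; the bi-infinite path is read off the increasing union. *)
Lemma dpath_extend l M :
  (forall p (v : obj L), exists l : mor L, deg l = p /\ ran l = v) ->
  (forall p (v : obj L), exists l : mor L, deg l = p /\ src l = v) ->
  exists x : dpaths L, forall a v, segment l M a v -> x a = v.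
Proof.
move=> /(_ ones)/choice[B BP] /(_ ones)/choice[A AP].
pose widen u := compose (A (ran u)) (compose u (B (src u))).
pose chain j := iter j widen l.
pose pos j : Zvec k := M - evec k *+ j.
have srcA u : src (A (ran u)) = ran u by case: (AP (ran u)).
have degA u : deg (A (ran u)) = ones by case: (AP (ran u)).
have ranB u : src u = ran (B (src u)) by case: (BP (src u)).
have degB u : deg (B (src u)) = ones by case: (BP (src u)).
have mono i j a v : (i <= j)%N ->
    segment (chain i) (pos i) a v -> segment (chain j) (pos j) a v.
  move=> /subnK <-; elim: (j - i)%N => // n IH /IH.
  have -> : pos (n.+1 + i)%N =
      pos (n + i)%N - zvec (deg (A (ran (chain (n + i)%N)))).
    by rewrite degA zvec_ones /pos addSn mulrS opprD addrA addrAC.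
  exact: segment_widen.
have deg_chain j : deg (chain j) = deg l + ones *+ j + ones *+ j.
  elim: j => [|j IH]; first by rewrite !mulr0n !addr0.
  rewrite /= /widen !deg_comp ?ran_comp //= IH degA degB.
  apply/ffunP => i; rewrite !ffunE !ffunMnE !ffunE !natn !natrDE; lia.
have ex a : exists v j, segment (chain j) (pos j) a v.
  (* Stage [N] occupies the interval from [M - N e] to [M + deg l + N e], with e = (1, ..., 1); this
     bound on all coordinates puts [a] inside it. *)
  have [N le_N] : exists N, forall i,
      (absz (delta_ran a i) + absz (delta_src a i) + absz (M i) <= N)%N.
    exists (\sum_i (absz (delta_ran a i) + absz (delta_src a i) + absz (M i)))%N.
    by move=> i; rewrite (bigD1 i) //= leq_addr.
  have [||v vP] := @segment_ex (chain N) (pos N) a.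
  - apply/lezP => i; have := le_N i; rewrite !ffunE ffunMnE ffunE natz.
    by move: (delta_ran a i) (delta_src a i) (M i) => u v w; lia.
  - apply/lezP => i; have := le_N i.
    rewrite deg_chain !zvecD !ffunE !ffunMnE !ffunE natz !natn.
    by move: (delta_ran a i) (delta_src a i) (M i) (deg l i) => u v w c; lia.
  by exists v, N.
have /choice[fm fmP] := ex.
(* The chosen value does not depend on the stage: by [mono] any two stages can be compared at the
   later one. *)
have fmE j a v : segment (chain j) (pos j) a v -> fm a = v.
  have [i iP] := fmP a => jP.
  apply: (@segment_inj (chain (maxn i j)) (pos (maxn i j)) a).
    by apply: mono iP; rewrite leq_maxl.
  by apply: mono jP; rewrite leq_maxr.
have deg_fm a : deg (fm a) = delta_deg a by have [j [u [w []]]] := fmP a.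
have fm_comp a b : delta_src a = delta_ran b ->
    src (fm a) = ran (fm b) /\ fm (delta_comp a b) = compose (fm a) (fm b).
  move=> ab; have [i iP] := fmP a; have [j jP] := fmP b.
  have [||-> /fmE ->] // := @segment_comp (chain (maxn i j)) (pos (maxn i j))
    a b (fm a) (fm b) ab.
  - by apply: mono iP; rewrite leq_maxl.
  - by apply: mono jP; rewrite leq_maxr.
pose fo n := ran (fm (delta_idm n)).
have ran_fm a : ran (fm a) = fo (delta_ran a).
  have [s_r e] := @fm_comp (delta_idm (delta_ran a)) a erefl.
  by rewrite -[a in LHS]delta_comp_idl e ran_comp.
have src_fm a : src (fm a) = fo (delta_src a).
  by have [-> _] := @fm_comp a (delta_idm (delta_src a)) erefl.
have fm_idm n : fm (delta_idm n) = idm (fo n).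
  by apply: deg0_idm; rewrite deg_fm delta_deg_idm.
exists (@DPath k L (@Functor (Delta k) L fo fm ran_fm src_fm fm_idm
  (fun a b ab => (fm_comp a b ab).2)) deg_fm) => a v lv /=.
by apply: (@fmE 0%N); rewrite /pos mulr0n subr0.
Qed.

End Factorization.

(** * Shifts, the metric at unit scale, and consequences of primitivity *)

Section Shift.
Set Implicit Arguments.
Unset Strict Implicit.
Context {k : nat} {L : kgraph k}.
Implicit Types x y : dpaths L.

Lemma dshiftK (n : Zvec k) : cancel (@dshift k L (- n)) (dshift n).
Proof.
move=> x; apply: dpath_ext => a /=; congr (fmor x _).
by apply: delta_ext; rewrite /delta_ran /delta_src /= addrK.
Qed.

Lemma open_cylinder (U : set (dpaths L)) x : open U -> U x ->
  exists l n, cylinder l n x /\ cylinder l n `<=` U.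
Proof.
move=> [D DB <-] [A DA Ax]; have [l [n e]] := DB _ DA.
by exists l, n; rewrite -e; split=> // y Ay; exists A.
Qed.

(** By contraposition. Distinct vertices at 0 give distance 1. Otherwise disagreement on [theta k 1]
    forces disagreement on each larger [theta k j], so the supremum is over j = 0 alone, h = 1 and
    the distance is exactly [r]. *)
Lemma rho_theta1 (R : realType) (r : R) x y : 0 < r -> r < 1 ->
  rho r x y < r -> x (theta k 1) = y (theta k 1).
Proof.
move=> r0 r1; rewrite /rho /agreement; case: asboolP => [xy0|_]; last first.
  by rewrite /= powRr0 => /lt_trans /(_ r1); rewrite ltxx.
apply: contraPP => xy1; apply/negP.
rewrite (_ : [set _ | _ in _] = [set 0%E]).
  by rewrite ereal_sup1 adde0 /= powRr1 ?ltxx // ltW.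
apply/seteqP; split => [_ [[|j] /= xyj <-] //|_ ->].
  case: xy1; apply: dpath_sub xyj; apply/lezP => i;
    rewrite /delta_ran /delta_src /= !ffunE !ffunMnE !ffunE; lia.
exists 0%N => //=; move: xy0; rewrite /dpath_at.
rewrite (_ : theta k 0 = delta_idm 0) //.
by apply: delta_ext; rewrite /delta_ran /delta_src /= ?mulr0n ?oppr0.
Qed.

Lemma dpath_eq_theta1 x y :
  (forall n, dshift n x (theta k 1) = dshift n y (theta k 1)) -> x = y.
Proof.
move=> xy; have xy1 n : x (seg n ones) = y (seg n ones).
  (* The unit cube (n, n + e) lies inside (n - e, n + e), the translate of [theta k 1] by [n]. *)
  apply: (@dpath_sub _ _ x y (translate n (theta k 1))) (xy n); apply/lezP => i;
    rewrite /delta_ran /delta_src /= !ffunE ?ffunMnE ?ffunE;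
    by move: (n i) => u; lia.
(* Unit cubes placed along the diagonal compose to arbitrarily long cubes. *)
have xyj n j : x (seg n (ones *+ j.+1)) = y (seg n (ones *+ j.+1)).
  elim: j => [|j IH]; first by rewrite mulr1n.
  have e : delta_src (seg n (ones *+ j.+1)) =
    delta_ran (seg (n + zvec (ones *+ j.+1)) ones) by [].
  have -> : seg n (ones *+ j.+2) =
      delta_comp (seg n (ones *+ j.+1)) (seg (n + zvec (ones *+ j.+1)) ones).
    apply: delta_ext; rewrite ?delta_ran_comp ?delta_src_comp //.
    by rewrite /delta_src /= -addrA -zvecD -mulrSr.
  by rewrite !(@fmor_comp _ _ (dpath_fun _) _ _ e) IH xy1.
apply: dpath_ext => a.
(* The sum of the coordinates of the degree bounds each of them, so this cube contains [a]. *)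
apply: (dpath_sub _ _ (xyj (delta_ran a) (\sum_i delta_deg a i)%N)).
  exact: lez_refl.
apply/lezP => i; rewrite zvec_delta_deg; move: (delta_ran a) (delta_deg a) => m p.
have : (p i <= \sum_j p j)%N by rewrite (bigD1 i) //= leq_addr.
rewrite /delta_src /= !ffunE ffunMnE ffunE natn lerD2l lez_nat; lia.
Qed.

(** A morphism of degree [q] with range [u] is followed by one of degree [p] from its source to [v];
    thus every degree above [p] connects all pairs of vertices. *)
Lemma primitive_ge : primitive L ->
  (forall p (v : obj L), exists l : mor L, deg l = p /\ ran l = v) ->
  exists p : Nvec k, forall q (u v : obj L),
    exists l : mor L, [/\ deg l = q + p, ran l = u & src l = v].
Proof.
move=> [p [_ pP]] ran_surj; exists p => q u v.
have [l [dl rl]] := ran_surj q u.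
have [m [dm rm sm]] := pP (src l) v.
by exists (compose l m); rewrite deg_comp // ran_comp // src_comp // dl dm.
Qed.

End Shift.

Theorem proposition3p1 (R : realType) (r : R) (r_gt0 : 0 < r) (r_lt1 : r < 1)
    (k : nat) (k_gt0 : (0 < k)%N) (L : kgraph k)
    (ran_surj : forall (p : Nvec k) (v : obj L),
      exists l : mor L, deg l = p /\ ran l = v)
    (src_surj : forall (p : Nvec k) (v : obj L),
      exists l : mor L, deg l = p /\ src l = v)
    (ran_fin : forall (p : Nvec k) (v : obj L),
      finite_set [set l : mor L | deg l = p /\ ran l = v])
    (src_fin : forall (p : Nvec k) (v : obj L),
      finite_set [set l : mor L | deg l = p /\ src l = v]) :
  (exists eps : R, 0 < eps /\
    forall x y : dpaths L,
      (forall n : Zvec k, rho r (dshift n x) (dshift n y) < eps) -> x = y) /\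
  (primitive L ->
    forall U V : set (dpaths L), open U -> open V -> U !=set0 -> V !=set0 ->
      exists Q : Zvec k, forall q : Zvec k, lez Q q ->
        (U `&` (dshift q @` V)) !=set0).
Proof.
split.
  exists r; split=> // x y xy; apply: dpath_eq_theta1 => n.
  exact: rho_theta1 (xy n).
move=> /primitive_ge/(_ ran_surj)[p pP] U V oU oV [x Ux] [y Vy].
have [l [m [_ lU]]] := open_cylinder oU Ux.
have [l' [n [_ lV]]] := open_cylinder oV Vy.
(* With this bound and [q] exceeding it by [d], the gap from [n - q + deg l'] to [m] is exactly
   [d + p], the degree of the connecting morphism [t]. *)
exists (n + zvec (deg l') + zvec p - m) => q /lez_zvecP[d qE].
have [t [dt rt st]] := pP d (src l') (ran l).
have [z zP] := dpath_extend (compose l' (compose t l)) (n - q) ran_surj src_surj.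
have zl : z (seg m (deg l)) = l.
  apply: zP; exists (compose l' t), (idm (src l)); split.
  - by rewrite src_comp.
  - by rewrite ran_idm.
  - by rewrite comp_idr Defs.compA.
  - rewrite deg_comp // dt !zvecD qE /delta_ran /=.
    apply/ffunP => i; rewrite !ffunE.
    by move: (m i) (n i) (deg l' i) (p i) (d i) => ? ? ? ? ?; lia.
  - by rewrite delta_deg_seg.
have zl' : z (seg (n - q) (deg l')) = l'.
  apply: zP; exists (idm (ran l')), (compose t l); split.
  - by rewrite src_idm.
  - by rewrite ran_comp.
  - by rewrite [RHS]Defs.compA ?comp_idl ?src_idm ?ran_comp //.
  - rewrite deg_idm /delta_ran /=; apply/ffunP => i; rewrite !ffunE.
    by move: (n i) (q i) => ? ?; lia.
  - by rewrite delta_deg_seg.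
exists z; split; first exact: lU.
(* Shifting by [-q] moves [l'] from position [n - q] to [n], which puts the preimage in [V]. *)
exists (dshift (- q) z); last exact: dshiftK.
apply: lV; rewrite /cylinder /= -[RHS]zl'; congr (fmor z _).
by apply: delta_ext; rewrite /delta_ran /delta_src //= addrAC.
Qed.
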